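(* Let $X$ be a real Hilbert space and let $A\colon X\rightrightarrows X$ be a maximally monotone operator. Let $x,x^*\in X$ and let $\gamma>0$. Then $$C_{A,\gamma}(x,x^* ) = C_{A^{-1},\gamma^{-1}}(x^*,x).$$
   Context: For a maximally monotone operator $B\colon X\rightrightarrows X$ on a real Hilbert space $X$ and $\gamma>0$, $J_{\gamma B}=(\mathrm{Id}+\gamma B)^{-1}$ denotes the resolvent of $\gamma B$, which is a single-valued map defined on all of $X$. The Carlier bound associated with $B$ and $\gamma$ is, for $(u,u^* )\in X\times X$, $$C_{B,\gamma}(u,u^* ) := \frac{\|u-J_{\gamma B}(u+\gamma u^* )\|^2}{\gamma}.$$ $A^{-1}$ denotes the set-valued inverse of $A$ ($x\in A^{-1}x^* \Leftrightarrow x^*\in Ax$), which is also maximally monotone. *)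

(* Defs.v *)
From HB Require Import structures.
From mathcomp Require Import all_boot all_order all_algebra sesquilinear.
From mathcomp Require Import all_classical all_reals all_analysis.

Set Implicit Arguments.
Unset Strict Implicit.
Unset Printing Implicit Defensive.

Import Order.TTheory GRing.Theory Num.Theory.
Import numFieldNormedType.Exports.

Local Open Scope classical_set_scope.
Local Open Scope ring_scope.

(* [{dot X for idfun}] are the symmetric positive definite bilinear forms. *)
HB.mixin Record CompleteNormedModule_isHilbert (R : realType) X
    of CompleteNormedModule R X := {
  inner : {dot X for (@idfun R)} ;
  inner_norm : forall x : X, inner x x = `|x| ^+ 2
}.

#[short(type="hilbertType")]
HB.structure Definition Hilbert (R : realType) :=
  { X of CompleteNormedModule_isHilbert R X & CompleteNormedModule R X }.

Section SetValuedOperators.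
Context {R : realType} {X : hilbertType R}.

(* [A x u] reads: u belongs to the set A x. *)
Implicit Types A B : X -> set X.

Definition op_monotone A : Prop :=
  forall x y u v : X, A x u -> A y v -> 0 <= inner (x - y) (u - v).

Definition maximally_monotone A : Prop :=
  op_monotone A /\
  forall B, op_monotone B -> (forall x, A x `<=` B x) -> B = A.

Definition op_inv A : X -> set X := fun u => [set x | A x u].

Definition op_id : X -> set X := fun x => [set x].

Definition op_add A B : X -> set X :=
  fun x => [set w | exists u v, [/\ A x u, B x v & w = u + v]].

Definition op_scale (a : R) A : X -> set X :=
  fun x => [set a *: u | u in A x].

Definition set_resolvent A : X -> set X := op_inv (op_add op_id A).

(* [get] picks an element of a nonempty set; for maximally monotone A and gamma > 0 the
   set is a singleton (Minty), so its only element is picked. *)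
Definition resolvent (gamma : R) A (z : X) : X :=
  get (set_resolvent (op_scale gamma A) z).

Definition Carlier_bound A (gamma : R) (u ustar : X) : R :=
  `|u - resolvent gamma A (u + gamma *: ustar)| ^+ 2 / gamma.

End SetValuedOperators.

(* Main.v *)
(** With z = x + gamma xstar and z' = xstar + gamma^-1 x = gamma^-1 z, the point p solves
    z - p in gamma A p iff q = gamma^-1 (z - p) solves z' - q in gamma^-1 A^-1 q; then
    x - p = gamma (q - xstar), which gives the equality.  That such a p exists is Minty's
    theorem, obtained here by minimising F(x, u) + (|x|^2 + |u|^2) / 2, with F the
    Fitzpatrick function of A.  As F(x, u) >= <x, u>, the optimality condition at the
    minimiser, tested against the graph of A, reads <y + u, v + x> >= |x + u|^2, so
    (-u, -x) lies in the graph of A; testing against this pair gives x + u = 0. *)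

Require Import Defs.
From mathcomp Require Import all_boot all_order all_algebra.
From mathcomp Require Import all_classical all_reals all_analysis.
From mathcomp Require Import sesquilinear ring lra.

Import Order.TTheory GRing.Theory Num.Theory.
Import numFieldNormedType.Exports.

Local Open Scope classical_set_scope.
Local Open Scope ring_scope.

Section HilbertOperators.
Context {R : realType} {X : hilbertType R}.
Implicit Types x y z : X.

(** * Inner product rules and limits of sequences *)

Lemma innerC x y : inner x y = inner y x.
Proof. by rewrite (hermC inner) expr0 mul1r. Qed.

Lemma innerDl x y z : inner (x + y) z = inner x z + inner y z.
Proof. exact: linearDl. Qed.

Lemma innerZl a x z : inner (a *: x) z = a * inner x z.
Proof. exact: linearZl_LR. Qed.

Lemma innerNl x z : inner (- x) z = - inner x z.
Proof. exact: linearNl. Qed.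

Lemma innerDr x y z : inner z (x + y) = inner z x + inner z y.
Proof. exact: linearDr. Qed.

Lemma innerZr a x z : inner z (a *: x) = a * inner z x.
Proof. exact: linearZr_LR. Qed.

Lemma innerNr x z : inner z (- x) = - inner z x.
Proof. exact: linearNr. Qed.

Definition innerE := (innerDl, innerDr, innerNl, innerNr, innerZl, innerZr).

Lemma inner_ge0 x : 0 <= inner x x.
Proof. by rewrite inner_norm exprn_ge0. Qed.

Lemma inner_le0 x : inner x x <= 0 -> x = 0.
Proof.
by rewrite inner_norm => h; apply/normr0_eq0/eqP; rewrite -sqrf_eq0 eq_le h exprn_ge0.
Qed.

(** Polarization reduces this to the continuity of the norm. *)
Lemma cvg_inner (f g : nat -> X) (a b : X) :
  f @ \oo --> a -> g @ \oo --> b ->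
  (fun n => inner (f n) (g n)) @ \oo --> inner a b.
Proof.
have polar (x y : X) :
    inner x y = (`|x + y| ^+ 2 - `|x| ^+ 2 - `|y| ^+ 2) * 2^-1.
  by rewrite -!inner_norm !innerE (innerC y x); field.
move=> fa gb; rewrite polar; under eq_fun do rewrite polar.
have sq (h : nat -> X) c : h @ \oo --> c -> (fun n => `|h n| ^+ 2) @ \oo --> `|c| ^+ 2.
  by move=> hc; rewrite expr2; under eq_fun do rewrite expr2; apply: cvgM; apply: cvg_norm.
apply: cvgMl; apply: cvgB; last exact: sq.
by apply: cvgB; apply: sq => //; apply: cvgD.
Qed.

Lemma cvg_dist_sq (f : nat -> X) (c : R) :
  (forall n k, `|f n - f k| ^+ 2 <= c * (n.+1%:R^-1 + k.+1%:R^-1)) ->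
  cvg (f @ \oo).
Proof.
move=> hf; apply/cauchy_cvgP/cauchy_exP => e e0 /=.
(* Two reciprocals below this tolerance add up to less than [e ^+ 2 / (|c| + 1)]; the denominator is
   positive whatever the sign of [c]. *)
have d0 : 0 < e ^+ 2 / (2 * (`|c| + 1)).
  by apply: divr_gt0; [exact: exprn_gt0|apply: mulr_gt0; rewrite // ltr_wpDl].
have [N _ hN] := near_infty_natSinv_lt (PosNum d0).
exists (f N); exists N => // k /= Nk; rewrite -ball_normE /=.
rewrite -(ltr_pXn2r (n := 2)) ?nnegrE ?(ltW e0) //.
apply: le_lt_trans (hf N k) _.
have hNN := hN N (leqnn N); have hNk := hN k Nk; rewrite /= in hNN hNk.
have S0 : 0 <= N.+1%:R^-1 + k.+1%:R^-1 :> R by rewrite addr_ge0.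
apply: (@le_lt_trans _ _ ((`|c| + 1) * (N.+1%:R^-1 + k.+1%:R^-1))).
  by apply: ler_wpM2r => //; have := ler_norm c; lra.
rewrite mulrC -ltr_pdivlMr ?ltr_wpDl //.
have -> : e ^+ 2 / (`|c| + 1) = e ^+ 2 / (2 * (`|c| + 1)) + e ^+ 2 / (2 * (`|c| + 1)).
  by field; rewrite gt_eqF // ltr_wpDl.
exact: ltrD.
Qed.


(** * Quadratic minimisation over closed convex sets *)

Lemma ge0_of_linear_perturbation (a b : R) :
  (forall s, 0 < s <= 1 -> 0 <= a + s * b) -> 0 <= a.
Proof.
move=> h; rewrite leNgt; apply/negP => a0.
have d0 : 0 < `|b| - a by have := normr_ge0 b; lra.
(* With this [s], [s * |b| = - a / 2 + s * a < - a / 2], so [a + s * b < a / 2 < 0]. *)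
pose s := - a / (2 * (`|b| - a)).
have s0 : 0 < s by rewrite divr_gt0 ?mulr_gt0 ?oppr_gt0.
have s1 : s <= 1.
  by rewrite ler_pdivrMr ?mulr_gt0 //; have := normr_ge0 b; lra.
have sE : s * `|b| - s * a = - a / 2 by rewrite /s; field; rewrite gt_eqF.
have := h s; rewrite s0 s1 => /(_ isT).
have := ler_wpM2l (ltW s0) (ler_norm b).
have : s * a < 0 by rewrite pmulr_rlt0.
lra.
Qed.

(* Minimises t + (|x|^2 + |u|^2) / 2 over C. *)
Lemma convex_proximal_point (C : X -> X -> R -> Prop) :
  (exists x u t, C x u t) ->
  (forall x u t, C x u t -> 0 <= t + (inner x x + inner u u) / 2) ->
  (forall x u t y v r (s : R), 0 <= s <= 1 -> C x u t -> C y v r ->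
    C (x + s *: (y - x)) (u + s *: (v - u)) (t + s * (r - t))) ->
  (forall (f g : nat -> X) (h : nat -> R) x u (t : R), (forall n, C (f n) (g n) (h n)) ->
    f @ \oo --> x -> g @ \oo --> u -> h @ \oo --> t -> C x u t) ->
  exists x u t, C x u t /\
    forall y v r, C y v r -> 0 <= (r - t) + inner x (y - x) + inner u (v - u).
Proof.
move=> [xi [ui [ti Ci]]] C_ge0 C_convex C_closed.
pose val (x u : X) (t : R) := t + (inner x x + inner u u) / 2.
pose E := [set w | exists x u t, C x u t /\ w = val x u t].
have E0 : E !=set0 by exists (val xi ui ti), xi, ui, ti.
have lbE : lbound E 0 by move=> _ [x [u [t [/C_ge0 h ->]]]].
have infE : has_inf E by split; [exact: E0|exists 0].
pose m := inf E.
have m_le x u t : C x u t -> m <= val x u t.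
  by move=> Ct; apply: ge_inf; [exists 0|exists x, u, t].
have /choice [w hw] : forall n : nat, exists p : X * X * R,
    C p.1.1 p.1.2 p.2 /\ val p.1.1 p.1.2 p.2 < m + n.+1%:R^-1.
  move=> n; have n0 : 0 < n.+1%:R^-1 :> R by rewrite invr_gt0.
  have [_ [x [u [t [Ct ->]]]] lt_m] := inf_adherent n0 infE.
  by exists (x, u, t).
pose f n := (w n).1.1; pose g n := (w n).1.2; pose h n := (w n).2.
have Cw n : C (f n) (g n) (h n) by case: (hw n).
have lt_w n : val (f n) (g n) (h n) < m + n.+1%:R^-1 by case: (hw n).
have half : 0 <= (2^-1 : R) <= 1 by lra.
(* Compare the value at the midpoint of two approximate minimisers with m. *)
have dist n k : inner (f n - f k) (f n - f k) + inner (g n - g k) (g n - g k)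
    <= 4 * (n.+1%:R^-1 + k.+1%:R^-1).
  (* By the parallelogram law the midpoint value is the mean of the two values minus 1/8 of the
     squared distance; the mean is below [m] plus half the sum of the errors, whence the factor
     4. *)
  have := m_le _ _ _ (C_convex _ _ _ _ _ _ _ half (Cw n) (Cw k)).
  have := lt_w n; have := lt_w k; rewrite /val !innerE.
  rewrite (innerC (f k) (f n)) (innerC (g k) (g n)).
  move: (n.+1%:R^-1) (k.+1%:R^-1) => en ek; lra.
have /cvg_ex[x fx] : cvg (f @ \oo).
  apply: (@cvg_dist_sq _ 4) => n k; rewrite -inner_norm.
  have := dist n k; have := inner_ge0 (g n - g k).
  by move: (n.+1%:R^-1) (k.+1%:R^-1) => en ek; lra.
have /cvg_ex[u gu] : cvg (g @ \oo).
  apply: (@cvg_dist_sq _ 4) => n k; rewrite -inner_norm.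
  have := dist n k; have := inner_ge0 (f n - f k).
  by move: (n.+1%:R^-1) (k.+1%:R^-1) => en ek; lra.
(* The limit of [h] is forced: the total value tends to [m] and its quadratic part converges. *)
pose t := m - (inner x x + inner u u) / 2.
have val_cvg : (fun n => val (f n) (g n) (h n)) @ \oo --> m.
  apply: (@squeeze_cvgr _ _ _ _ (fun=> m) (fun n => m + n.+1%:R^-1)).
  - by apply: nearW => n; rewrite m_le //= ltW.
  - exact: cvg_cst.
  - rewrite -[X in _ --> X]addr0; apply: cvgD; first exact: cvg_cst.
    exact: cvg_harmonic.
have ht : h @ \oo --> t.
  have -> : h = fun n =>
      val (f n) (g n) (h n) - (inner (f n) (f n) + inner (g n) (g n)) * 2^-1.
    by apply/funext => n; rewrite /val addrK.
  apply: cvgB => //; apply: cvgMl; apply: cvgD; exact: cvg_inner.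
have Ct := C_closed _ _ _ _ _ _ Cw fx gu ht.
exists x, u, t; split => // y v r Cr.
(* Moving by [s] towards [(y, v, r)] changes the value by [s] times the claimed expression plus
   [s ^+ 2] times this coefficient; minimality makes the change nonnegative. *)
apply: (@ge0_of_linear_perturbation _
  ((inner (y - x) (y - x) + inner (v - u) (v - u)) / 2)) => s /andP[s0 s1].
have s01 : 0 <= s <= 1 by rewrite (ltW s0).
rewrite -(pmulr_rge0 _ s0).
have := m_le _ _ _ (C_convex _ _ _ _ _ _ _ s01 Ct Cr).
rewrite /val -subr_ge0; congr (0 <= _).
by rewrite /t !innerE (innerC y x) (innerC v u); field.
Qed.

(** * Maximality and Minty's theorem *)

Lemma maximally_monotone_mem (A : X -> set X) (x u : X) :
  maximally_monotone A ->
  (forall y v, A y v -> 0 <= inner (x - y) (u - v)) -> A x u.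
Proof.
move=> [mA maxA] rel.
(* Adding the pair [(x, u)] to the graph keeps it monotone, so maximality absorbs it. *)
pose B : X -> set X := fun y => [set v | A y v \/ y = x /\ v = u].
have <- : B = A; last by right.
apply: maxA; last by move=> y v; left.
move=> y y' v v' [Ayv|[-> ->]] [Ayv'|[-> ->]].
- exact: mA.
- by rewrite -opprB -[v - u]opprB innerNl innerNr opprK rel.
- exact: rel.
- by rewrite subrr -(scale0r x) innerZl mul0r.
Qed.

(** Maximality is stated pointwise because this form passes directly to the translated and scaled
    operator in [set_resolvent_nonempty]. *)
Lemma Minty_zero (A : X -> set X) :
  op_monotone A ->
  (forall x u, (forall y v, A y v -> 0 <= inner (x - y) (u - v)) -> A x u) ->
  exists x, A x (- x).
Proof.
move=> mA memA.
(* C is the epigraph of the Fitzpatrick function of A. *)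
pose C (x u : X) (t : R) := forall y v, A y v -> inner x v + inner y u - inner y v <= t.
have AC y v : A y v -> C y v (inner y v).
  move=> Ayv y' v' Ayv'; have := mA _ _ _ _ Ayv Ayv'; rewrite !innerE; lra.
(* If [t < inner x u], the epigraph inequalities make [(x, u)] monotonically related to the graph,
   hence a member; testing it against itself is then a contradiction. *)
have C_ge x u t : C x u t -> inner x u <= t.
  move=> Ct; rewrite leNgt; apply/negP => t_lt.
  have Axu : A x u.
    by apply: memA => y v /Ct; rewrite !innerE; lra.
  by have := Ct _ _ Axu; lra.
have C_ge0 x u t : C x u t -> 0 <= t + (inner x x + inner u u) / 2.
  move/C_ge; have := inner_ge0 (x + u); rewrite !innerE (innerC u x); lra.
have [||||x [u [t [Ct opt]]]] := @convex_proximal_point C.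
- have [[y [v Ayv]]|nA] := pselect (exists y v, A y v).
    by exists y, v, (inner y v); exact: AC.
  (* For an empty graph, [C] holds vacuously everywhere. *)
  by exists 0, 0, 0 => y v Ayv; case: nA; exists y, v.
- exact: C_ge0.
- move=> x u t y v r s /andP[s0 s1] Ct Cr a b Aab.
  have s1' : 0 <= 1 - s by lra.
  have := ler_wpM2l s0 (Cr _ _ Aab); have := ler_wpM2l s1' (Ct _ _ Aab).
  rewrite !innerE; lra.
- move=> f g h x u t Cn fx gu ht y v Ayv.
  have lhs_cvg : (fun n => inner (f n) v + inner y (g n) - inner y v) @ \oo
      --> inner x v + inner y u - inner y v.
    apply: cvgB; last exact: cvg_cst.
    by apply: cvgD; apply: cvg_inner => //; exact: cvg_cst.
  by apply: ler_cvg_to lhs_cvg ht _; apply: nearW => n; exact: Cn.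
have tight y v : A y v -> inner (x + u) (x + u) <= inner (y + u) (v + x).
  move=> Ayv; have := opt _ _ _ (AC _ _ Ayv); have := C_ge _ _ _ Ct.
  rewrite !innerE (innerC u x) (innerC x y); lra.
have Aux : A (- u) (- x).
  apply: memA => y v /tight; have := inner_ge0 (x + u).
  rewrite !innerE; lra.
have /inner_le0/eqP : inner (x + u) (x + u) <= 0.
  by apply: le_trans (tight _ _ Aux) _; rewrite addNr -(scale0r x) innerZl mul0r.
by rewrite addr_eq0 => /eqP xu; exists x; rewrite {1}xu.
Qed.

(** * Existence and uniqueness of resolvent points *)

Lemma set_resolventE (gamma : R) (A : X -> set X) (z p : X) : 0 < gamma ->
  set_resolvent (op_scale gamma A) z p <-> A p (gamma^-1 *: (z - p)).
Proof.
move=> g0; have gN0 : gamma != 0 by rewrite gt_eqF.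
split.
  move=> [_ [_ [-> [v Av <-] ->]]].
  by rewrite addrAC subrr add0r scalerA mulVf // scale1r.
move=> Ap; exists p, (z - p); split; last by rewrite addrC subrK.
- by [].
- by exists (gamma^-1 *: (z - p)) => //; rewrite scalerA mulfV // scale1r.
Qed.

Lemma set_resolvent_nonempty (gamma : R) (A : X -> set X) (z : X) :
  maximally_monotone A -> 0 < gamma ->
  exists p, set_resolvent (op_scale gamma A) z p.
Proof.
move=> maxA g0; have gN0 : gamma != 0 by rewrite gt_eqF.
(* The problem for z becomes the one for 0 after replacing A by y |-> gamma A (y + z). *)
have [||y Ay] := @Minty_zero (fun y => [set v | A (y + z) (gamma^-1 *: v)]).
- move=> x y u v /= Axu Ayv; have := maxA.1 _ _ _ _ Axu Ayv.
  by rewrite opprD addrACA subrr addr0 -scalerBr innerZr pmulr_rge0 // invr_gt0.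
- move=> x u rel; apply: maximally_monotone_mem => // a b Aab.
  have /rel : A (a - z + z) (gamma^-1 *: (gamma *: b)).
    by rewrite subrK scalerA mulVf // scale1r.
  have -> : u - gamma *: b = gamma *: (gamma^-1 *: u - b).
    by rewrite scalerBr scalerA mulfV // scale1r.
  by rewrite innerZr pmulr_rge0 // opprB addrA addrAC.
exists (y + z); apply/set_resolventE => //.
by rewrite opprD addrCA subrr addr0.
Qed.

(** The two values of [A] differ by [- gamma^-1 *: (p - q)], so monotonicity forces the squared norm
    of [p - q] to be at most 0. *)
Lemma set_resolvent_unique (gamma : R) (A : X -> set X) (z p q : X) :
  op_monotone A -> 0 < gamma ->
  set_resolvent (op_scale gamma A) z p -> set_resolvent (op_scale gamma A) z q ->
  p = q.
Proof.
move=> mA g0 /(set_resolventE _ _ _ _ g0) Ap /(set_resolventE _ _ _ _ g0) Aq.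
have := mA _ _ _ _ Ap Aq.
have -> : gamma^-1 *: (z - p) - gamma^-1 *: (z - q) = - (gamma^-1 *: (p - q)).
  by rewrite -scalerBr -scalerN opprB; congr (_ *: _); rewrite opprB addrC addrA subrK addrC.
rewrite innerNr innerZr oppr_ge0 pmulr_rle0 ?invr_gt0 // => /inner_le0/eqP.
by rewrite subr_eq0 => /eqP.
Qed.

End HilbertOperators.

Local Close Scope classical_set_scope.

Theorem theorem4p5 (R : realType) (X : hilbertType R) (A : X -> set X)
    (hA : maximally_monotone A) (x xstar : X) (gamma : R) (hgamma : 0 < gamma) :
  Carlier_bound A gamma x xstar = Carlier_bound (op_inv A) gamma^-1 xstar x.
Proof.
have gN0 : gamma != 0 by rewrite gt_eqF.
have g'0 : 0 < gamma^-1 by rewrite invr_gt0.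
pose z := x + gamma *: xstar.
pose z' := xstar + gamma^-1 *: x.
have zE : z = gamma *: z' by rewrite scalerDr scalerA mulfV // scale1r addrC.
have exP := set_resolvent_nonempty _ _ z hA hgamma.
have Pp : set_resolvent (op_scale gamma A) z (resolvent gamma A z) := getPex exP.
(* A resolvent point for the inverse is built from one for [A]. *)
have exQ : exists q, set_resolvent (op_scale gamma^-1 (op_inv A)) z' q.
  have [p /(set_resolventE _ _ _ _ hgamma) Ap] := exP.
  exists (gamma^-1 *: (z - p)); apply/set_resolventE => //.
  have -> : gamma^-1 *: (z - p) = z' - gamma^-1 *: p.
    by rewrite scalerBr zE scalerA mulVf // scale1r.
  rewrite subKr invrK scalerA mulfV // scale1r /op_inv /=.
  by rewrite scalerBr zE scalerA mulVf // scale1r in Ap.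
have := getPex exQ; rewrite -/(resolvent gamma^-1 (op_inv A) z').
set q := resolvent _ _ z' => /(set_resolventE _ _ _ _ g'0); rewrite invrK /op_inv /= => Aq.
(* The chosen [q] yields a solution of the inclusion for [A]; uniqueness identifies it with the
   point picked by [get]. *)
have pE : resolvent gamma A z = gamma *: (z' - q).
  apply: (set_resolvent_unique _ _ _ _ _ hA.1 hgamma Pp); apply/set_resolventE => //.
  by rewrite zE -scalerBr subKr scalerA mulVf // scale1r.
rewrite /Carlier_bound -/z -/z' -/q pE.
have -> : x - gamma *: (z' - q) = - (gamma *: (xstar - q)).
  rewrite /z' addrAC scalerDr scalerA mulfV // scale1r.
  by rewrite opprD addrCA subrr addr0.
rewrite normrN normrZ gtr0_norm //.
by field.
Qed.
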